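(* Let $\Lambda$ be a finite $k$-graph without sinks or sources. Suppose that $D\in\mathcal{C}$ is hereditary, and set $H:=\{v\in\Lambda^0:v\Lambda D=\emptyset\}$. Suppose that $$L_D:=\{i\in\{1,\dots,k\}:\rho(A_{C,i})<\rho(A_{D,i})\text{ for all }C\in\mathcal{C}\setminus\{D\}\text{ with }C\Lambda D\ne\emptyset\}$$ is nonempty, and that $x$ is a nonnegative vector which, for every $1\le i\le k$, is an eigenvector of $A_{D,i}$ with eigenvalue $\rho(A_{D,i})$. Write $F:=\Lambda^0\setminus(D\cup H)$. Then with respect to the decomposition $\Lambda^0=F\sqcup D\sqcup H$ the vertex matrices have block form $$A_i=\begin{pmatrix}E_i&B_i&\star\\0&A_{D,i}&0\\0&0&A_{H,i}\end{pmatrix}\qquad(1\le i\le k).$$ Moreover: (a) For $1\le i,j\le k$ we have $(\rho(A_{D,i})1_F-E_i)B_jx=(\rho(A_{D,j})1_F-E_j)B_ix$. (b) For $i,j\in L_D$ we have $(\rho(A_{D,i})1_F-E_i)^{-1}B_ix=(\rho(A_{D,j})1_F-E_j)^{-1}B_jx$. Write $y$ for this common vector. Then $y$ is nonnegative, and for every $i\in\{1,\dots,k\}$, $(y,x,0)$ is an eigenvector of $A_i$ with eigenvalue $\rho(A_{D,i})$.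
   Context: $\mathbb{N}=\{0,1,2,\dots\}$. A $k$-graph is a countable category $\Lambda$ with a functor $d:\Lambda\to\mathbb{N}^k$ such that whenever $d(\lambda)=m+n$ there are unique $\mu,\nu\in\Lambda$ with $d(\mu)=m$, $d(\nu)=n$, $\lambda=\mu\nu$. $\Lambda^n:=d^{-1}(n)$; $\Lambda^0$ (the vertices) is identified with the objects. The maps $s,r:\Lambda\to\Lambda^0$ are domain and codomain. For $V\subset\Lambda^0$, $E\subset\Lambda$: $VE=\{\lambda\in E:r(\lambda)\in V\}$, $EV=\{\lambda\in E:s(\lambda)\in V\}$, $vE=\{v\}E$, $Ev=E\{v\}$. $e_1,\dots,e_k$ are the generators of $\mathbb{N}^k$. $\Lambda$ is finite if every $\Lambda^n$ is finite; it has no sources (sinks) if $v\Lambda^n\ne\emptyset$ ($\Lambda^nv\neq\emptyset$) for all $v\in\Lambda^0$, $n\in\mathbb{N}^k$. The vertex matrix $A_i$ is the $\Lambda^0\times\Lambda^0$ matrix $A_i(v,w)=|v\Lambda^{e_i}w|$; for $C\subset\Lambda^0$, $A_{C,i}$ is its $C\times C$ block; $\rho$ is the spectral radius. $1_F$ is the $F\times F$ identity matrix. Strongly connected components are the classes of the relation $v\sim w\iff v\Lambda w\neq\emptyset$ and $w\Lambda v\ne\emptyset$; a class $\{v\}$ with $v\Lambda v=\{v\}$ is trivial; $\mathcal{C}$ is the set of nontrivial strongly connected components. A set $H\subset\Lambda^0$ is hereditary if $v\in H$ and $v\Lambda w\ne\emptyset$ imply $w\in H$. *)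

(* Defs.v *)
From HB Require Import structures.
From mathcomp Require Import all_boot all_order all_algebra finmap.
From mathcomp Require Import all_classical all_reals.
From mathcomp Require Import complex.

Set Implicit Arguments.
Unset Strict Implicit.
Unset Printing Implicit Defensive.

Import Order.TTheory GRing.Theory Num.Theory.
Local Open Scope classical_set_scope.
Local Open Scope ring_scope.

(* The objects are the vertices, and [hom v w] is the set v Lambda w of
   morphisms with range (codomain) v and source (domain) w, so that [comp mu nu]
   is the composite mu nu, defined when s(mu) = r(nu).  Countability of the
   category is carried by the [countType]s. *)
Record kgraph (k : nat) := KGraph {
  vertex : countType;
  hom : vertex -> vertex -> countType;
  idp : forall v, hom v v;
  comp : forall u v w, hom u v -> hom v w -> hom u w;
  deg : forall v w, hom v w -> {ffun 'I_k -> nat};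
  compA : forall u v w z (a : hom u v) (b : hom v w) (c : hom w z),
    comp a (comp b c) = comp (comp a b) c;
  comp1p : forall v w (a : hom v w), comp (idp v) a = a;
  compp1 : forall v w (a : hom v w), comp a (idp w) = a;
  deg_idp : forall v, deg (idp v) = 0;
  deg_comp : forall u v w (a : hom u v) (b : hom v w),
    deg (comp a b) = deg a + deg b;
  factorization : forall u w (l : hom u w) (m n : {ffun 'I_k -> nat}),
    deg l = m + n ->
    exists! p : {v : vertex & (hom u v * hom v w)%type},
      [/\ deg (tagged p).1 = m, deg (tagged p).2 = n
        & comp (tagged p).1 (tagged p).2 = l]
}.

Arguments hom {k L} v w : rename.
Arguments idp {k L} v : rename.
Arguments comp {k L u v w} a b : rename.
Arguments deg {k L v w} l : rename.

Section KGraph.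
Variables (k : nat) (L : kgraph k).
Implicit Types (v w : vertex L) (C D X Y : set (vertex L)).
Implicit Types (n : {ffun 'I_k -> nat}) (i : 'I_k).

Definition path := {rs : vertex L * vertex L & hom rs.1 rs.2}.

Definition mkpath v w (l : hom v w) : path :=
  @Tagged _ (v, w) (fun rs => hom rs.1 rs.2) l.

Definition path_deg (p : path) : {ffun 'I_k -> nat} := deg (tagged p).

(* The identification of the degree-zero morphisms with the vertices. *)
Lemma deg0_idp v w (l : hom v w) : deg l = 0 -> mkpath l = mkpath (idp v).
Proof.
move=> l0.
have [p [_ pU]] : exists! p : {u : vertex L & (hom v u * hom u w)%type},
    [/\ deg (tagged p).1 = 0, deg (tagged p).2 = 0
      & comp (tagged p).1 (tagged p).2 = l].
  by apply: factorization; rewrite l0 addr0.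
pose T u := (hom v u * hom u w)%type.
have e1 := pU (@Tagged _ v T (idp v, l)) (And3 (deg_idp v) l0 (comp1p l)).
have e2 := pU (@Tagged _ w T (l, idp w)) (And3 l0 (deg_idp w) (compp1 l)).
by rewrite e1 in e2; have := congr1 (fun q => mkpath (tagged q).1) e2.
Qed.

Definition finite_kgraph := forall n, finite_set [set p : path | path_deg p = n].

Definition no_sources := forall v n, exists w, exists l : hom v w, deg l = n.

Definition no_sinks := forall v n, exists u, exists l : hom u v, deg l = n.

Definition unit_deg i : {ffun 'I_k -> nat} := [ffun j => (j == i) : nat].

(* v Lambda w is nonempty (and X Lambda Y, below). *)
Definition connected v w : Prop := inhabited (hom v w).

Definition connected_sets X Y : Prop :=
  exists v w, [/\ X v, Y w & connected v w].

Definition scc v : set (vertex L) :=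
  [set w | connected v w /\ connected w v].

Definition trivial_component C : Prop :=
  exists v, C = [set v] /\ forall l : hom v v, l = idp v.

Definition nontrivial_components : set (set (vertex L)) :=
  [set C | (exists v, C = scc v) /\ ~ trivial_component C].

Definition hereditary X : Prop := forall v w, X v -> connected v w -> X w.

(* The entry A_i(v, w); the cardinal is meaningful because finite_kgraph makes
   the set finite. *)
Definition edge_count i v w : nat :=
  #|` fset_set [set l : hom v w | deg l = unit_deg i] |%fset.

(* Matrices indexed by (finite) sets of vertices are indexed by the ordinals
   below their cardinals, through the enumeration [elt]. *)
Definition vcard X : nat := #|` fset_set X|%fset.

Definition elt X : 'I_(vcard X) -> vertex L :=
  tnth (in_tuple (enum_fset (fset_set X))).

Definition edge_mx (R : realType) (m n : nat) (f : 'I_m -> vertex L)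
    (g : 'I_n -> vertex L) i : 'M[R]_(m, n) :=
  \matrix_(p, q) (edge_count i (f p) (g q))%:R.

(* The X x Y block of the vertex matrix A_i; A_{C,i} is [vertex_block R C C i]. *)
Definition vertex_block (R : realType) X Y i : 'M[R]_(vcard X, vcard Y) :=
  edge_mx R (@elt X) (@elt Y) i.

Definition elt3 X Y Z (p : 'I_(vcard X + (vcard Y + vcard Z))) : vertex L :=
  match fintype.split p with
  | inl a => elt a
  | inr b => match fintype.split b with inl c => elt c | inr d => elt d end
  end.

End KGraph.

Arguments edge_mx {k L} R {m n} f g i.
Arguments vertex_block {k L} R X Y i.
Arguments elt3 {k L} X Y Z p.

(* The maximum of the moduli of the complex eigenvalues. *)
Definition spectral_radius (R : realType) n (A : 'M[R]_n) : R :=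
  sup [set ComplexField.Normc.normc z | z in
        [set z : R[i] | eigenvalue (map_mx (real_complex R) A) z]].

Definition eigenvector (R : realType) n (A : 'M[R]_n) (a : R) (v : 'cV[R]_n) :=
  v != 0 /\ A *m v = a *: v.

Definition nonneg_vec (R : realType) n (v : 'cV[R]_n) :=
  forall p, 0 <= v p ord0.

Definition dominant_colours (R : realType) k (L : kgraph k)
    (D : set (vertex L)) : set 'I_k :=
  [set i | forall C : set (vertex L),
     nontrivial_components C -> C <> D -> connected_sets C D ->
     spectral_radius (vertex_block R C C i)
       < spectral_radius (vertex_block R D D i)].

(* Main.v *)
Require Import Defs.
From HB Require Import structures.
From mathcomp Require Import all_boot all_order all_algebra finmap.
From mathcomp Require Import all_classical all_reals.
From mathcomp Require Import complex polyrcf.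
From mathcomp Require Import lra.

Set Implicit Arguments.
Unset Strict Implicit.
Unset Printing Implicit Defensive.

Import Order.TTheory GRing.Theory Num.Theory.
Local Open Scope classical_set_scope.
Local Open Scope ring_scope.

(* The factorization property makes the vertex matrices commute: the (v, w) entry
   of A_i A_j counts the paths from w to v of degree e_i + e_j.  Comparing blocks
   gives E_i E_j = E_j E_i and E_i B_j + B_i A_{D,j} = E_j B_i + B_j A_{D,i};
   the latter applied to x is (a), and with the former it yields
   (rho_j - E_j) y = B_j x for y = (rho_i - E_i)^-1 B_i x and every j, which is
   both the independence of y from i and the eigenvector equation.
   For i in L_D, rho_i - E_i has a nonnegative inverse because E_i has no real
   eigenvalue t >= rho_i: the restriction of a t-eigenvector to a strongly
   connected class minimal in its support would be a t-eigenvector of the block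
   of that class, hence t = 0 or t <= rho(A_{C,i}) < rho_i, whereas rho_i > 0 as
   x is strictly positive. *)

(** * Nonnegative matrices *)

Section NonnegMatrices.
Variable R : realType.

Definition nonneg_mx m n (A : 'M[R]_(m, n)) := forall p q, 0 <= A p q.

Lemma nonneg_mulmx_vec m n (A : 'M[R]_(m, n)) (v : 'cV[R]_n) :
  nonneg_mx A -> nonneg_vec v -> nonneg_vec (A *m v).
Proof.
move=> A_ge0 v_ge0 p; rewrite mxE; apply: sumr_ge0 => q _.
exact: mulr_ge0.
Qed.

Lemma scalar_submx_mulE n (A : 'M[R]_n) (t : R) (v : 'cV[R]_n) p :
  ((t%:M - A) *m v) p 0 = t * v p 0 - \sum_q A p q * v q 0.
Proof. by rewrite mulmxBl mul_scalar_mx !mxE. Qed.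

(** * M-matrix criterion: a positive vector [z] with [A z < t z] entrywise *)

Section TestVector.
Variables (n : nat) (A : 'M[R]_n) (t : R) (z : 'cV[R]_n).
Hypothesis A_ge0 : nonneg_mx A.
Hypothesis z_gt0 : forall p, 0 < z p 0.
Hypothesis Az_lt : forall p, 0 < ((t%:M - A) *m z) p 0.

(* Look at an index minimizing u p / z p. *)
Lemma test_vector_nonneg (u : 'cV[R]_n) :
  nonneg_vec ((t%:M - A) *m u) -> nonneg_vec u.
Proof.
move=> Mu_ge0 p0.
case: (@arg_minP _ _ _ p0 xpredT (fun p => u p 0 / z p 0) isT) => m _ m_min.
set c := u m 0 / z m 0 in m_min.
have czu p : c * z p 0 <= u p 0 by rewrite -ler_pdivlMr ?m_min.
suff c_ge0 : 0 <= c.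
  by apply: le_trans (czu p0); apply: mulr_ge0 => //; apply: ltW.
rewrite leNgt; apply/negP => c_lt0.
(* As u >= c z with equality at m, row m of (t - A) u is at most c times row m of (t - A) z, which
   is negative when c < 0. *)
have := Mu_ge0 m; have := Az_lt m; rewrite !scalar_submx_mulE.
have -> : u m 0 = c * z m 0 by rewrite /c divfK // gt_eqF.
have : c * \sum_q A m q * z q 0 <= \sum_q A m q * u q 0.
  rewrite mulr_sumr; apply: ler_sum => q _.
  by rewrite mulrCA ler_wpM2l.
by nra.
Qed.

(** A kernel vector and its negative both satisfy the hypothesis of [test_vector_nonneg], so the
    kernel is zero. *)
Lemma test_vector_unitmx : t%:M - A \in unitmx.
Proof.
rewrite -unitmx_tr -row_free_unit -kermx_eq0; apply/eqP/row_matrixP => i.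
rewrite row0; set v := row i _.
have Mv : (t%:M - A) *m v^T = 0.
  apply: trmx_inj; rewrite trmx_mul trmxK trmx0.
  by apply/sub_kermxP; apply: row_sub.
have v_ge0 : nonneg_vec v^T.
  by apply: test_vector_nonneg => p; rewrite Mv mxE.
have v_le0 : nonneg_vec (- v^T).
  by apply: test_vector_nonneg => p; rewrite mulmxN Mv oppr0 mxE.
apply/rowP => q; have := v_ge0 q; have := v_le0 q; rewrite !mxE => h1 h2.
by apply/eqP; rewrite eq_le h2 -oppr_ge0 h1.
Qed.

Lemma test_vector_invmx_nonneg (b : 'cV[R]_n) :
  nonneg_vec b -> nonneg_vec (invmx (t%:M - A) *m b).
Proof.
move=> b_ge0; apply: test_vector_nonneg.
by rewrite mulmxA mulmxV ?test_vector_unitmx // mul1mx.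
Qed.

End TestVector.

(** Row p reads t z_p = 1 + (A z)_p >= 1. Such a [z] is therefore a test vector at t. *)
Lemma nonneg_resolvent_gt0 n (A : 'M[R]_n) (t : R) (z : 'cV[R]_n) :
  0 < t -> nonneg_mx A -> nonneg_vec z -> (t%:M - A) *m z = const_mx 1 ->
  forall p, 0 < z p 0.
Proof.
move=> t_gt0 A_ge0 z_ge0 Mz p; rewrite -(pmulr_rgt0 _ t_gt0).
have := congr1 (fun v : 'cV_n => v p 0) Mz; rewrite scalar_submx_mulE mxE.
have : 0 <= \sum_q A p q * z q 0.
  by apply: sumr_ge0 => q _; apply: mulr_ge0.
by move=> ? ?; lra.
Qed.

Lemma horner_char_poly_mx n (A : 'M[R]_n) (t : R) :
  map_mx (horner_eval t) (char_poly_mx A) = t%:M - A.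
Proof.
apply/matrixP => p q; rewrite !mxE /horner_eval !hornerE hornerMn hornerX.
by [].
Qed.

(* Real induction downwards from a large t: the set of t at which the resolvent
   is nonnegative is open by the test vector criterion, and closed because the
   entries of the resolvent are rational functions of t. *)
Lemma nonneg_resolvent n (A : 'M[R]_n) (r : R) :
  0 < r -> nonneg_mx A -> (forall t, r <= t -> t%:M - A \in unitmx) ->
  exists2 z : 'cV[R]_n, nonneg_vec z & (r%:M - A) *m z = const_mx 1.
Proof.
move=> r_gt0 A_ge0 A_unit.
pose S := [set t | r <= t /\ exists2 z : 'cV[R]_n,
  nonneg_vec z & (t%:M - A) *m z = const_mx 1].
have SI t (z : 'cV[R]_n) : r <= t -> (forall p, 0 < z p 0) ->
    (forall p, 0 < ((t%:M - A) *m z) p 0) -> S t.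
  move=> rt z_gt0 Mz; split=> //; exists (invmx (t%:M - A) *m const_mx 1).
    apply: (test_vector_invmx_nonneg A_ge0 z_gt0 Mz) => p.
    by rewrite mxE ler01.
  by rewrite mulmxA mulmxV ?A_unit // mul1mx.
have S_neq0 : S !=set0.
  (* With s the sum of all entries, every row sum of A is at most s < r + s, so the constant vector
     1 is a test vector at r + s. *)
  pose s := \sum_p \sum_q A p q.
  have row_ge0 p : 0 <= \sum_q A p q by apply: sumr_ge0.
  have s_ge0 : 0 <= s by apply: sumr_ge0.
  exists (r + s); apply: (SI _ (const_mx 1)) => [|p|p]; first by rewrite lerDl.
    by rewrite mxE ltr01.
  rewrite scalar_submx_mulE mxE mulr1.
  under eq_bigr do rewrite mxE mulr1.
  have : \sum_q A p q <= s.
    by rewrite /s [leRHS](bigD1 p) //= lerDl; apply: sumr_ge0.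
  by move=> ?; lra.
have S_lb : has_lbound S by exists r => t [].
pose t0 := inf S.
have rt0 : r <= t0 by apply: lb_le_inf => // t [].
have t0_unit := A_unit _ rt0.
(* Cramer's rule: the solution of (t - A) z = 1 is q(t) / d(t) with polynomial numerators and
   denominator. *)
pose d := char_poly A.
pose q := \adj (char_poly_mx A) *m (const_mx 1 : 'cV_n).
have qdE t (z : 'cV_n) : (t%:M - A) *m z = const_mx 1 ->
    forall p, (q p 0).[t] = d.[t] * z p 0.
  move=> Mz p.
  have -> : (q p 0).[t] = (map_mx (horner_eval t) q) p 0 by rewrite [RHS]mxE.
  rewrite map_mxM map_mx_adj horner_char_poly_mx map_const_mx rmorph1.
  rewrite -Mz mulmxA mul_adj_mx mul_scalar_mx mxE; congr (_ * _).
  rewrite -horner_char_poly_mx det_map_mx; reflexivity.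
have St0 : S t0.
  split=> //; exists (invmx (t0%:M - A) *m const_mx 1); last first.
    by rewrite mulmxA mulmxV // mul1mx.
  set z := _ *m _; move=> p.
  have Mz : (t0%:M - A) *m z = const_mx 1 by rewrite mulmxA mulmxV // mul1mx.
  have dt0 : d.[t0] != 0.
    have := t0_unit; rewrite unitmxE -horner_char_poly_mx det_map_mx unitfE.
    by [].
  (* The product q d = d^2 z has the sign of z whatever the sign of d. Were it negative at t0, it
     would be negative at points of S close to t0, where it is d^2 w with w >= 0. *)
  have : 0 <= (q p 0 * d).[t0].
    rewrite leNgt; apply/negP => neg.
    have [e e_gt0 near] : exists2 e, e > 0 &
        forall y, `|y - t0| < e ->
        `|(q p 0 * d).[y] - (q p 0 * d).[t0]| < - (q p 0 * d).[t0].
      by apply: poly_cont; rewrite oppr_gt0.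
    have [t St tlt] := inf_adherent e_gt0 (conj S_neq0 S_lb).
    have t0t : t0 <= t by apply: ge_inf.
    have /near : `|t - t0| < e by rewrite ger0_norm ?subr_ge0 // ltrBlDl.
    have [_ [w w_ge0 Mw]] := St.
    have : 0 <= (q p 0 * d).[t].
      by rewrite hornerM (qdE _ _ Mw) mulrAC -expr2 mulr_ge0 // sqr_ge0.
    by rewrite ltr_norml => ? /andP[_ ?]; lra.
  rewrite hornerM (qdE _ _ Mz) mulrAC -expr2 pmulr_rge0 //.
  by rewrite exprn_even_gt0 //= dt0.
suff -> : r = t0 by have [_] := St0.
apply/eqP; rewrite eq_le rt0 /= leNgt; apply/negP => rt.
have [_ [z z_ge0 Mz]] := St0.
have t0_gt0 : 0 < t0 by apply: lt_trans rt.
have z_gt0 := nonneg_resolvent_gt0 t0_gt0 A_ge0 z_ge0 Mz.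
pose s := \sum_p z p 0.
have s_ge0 : 0 <= s by apply: sumr_ge0 => p _; apply: z_ge0.
(* The first bound keeps t0 - e >= r. The second gives e z_p <= e s < 1, so (t0 - e - A) z = 1 - e z
   is still positive and t0 - e lies in S, below its infimum. *)
pose e := Num.min (t0 - r) (s + 1)^-1.
have e_gt0 : 0 < e by rewrite lt_min subr_gt0 rt invr_gt0 ltr_wpDl.
have : S (t0 - e).
  apply: (SI _ z) => // [|p].
    by rewrite lerBrDr addrC -lerBrDr ge_min lexx.
  have -> : (t0 - e)%:M - A = (t0%:M - A) - e%:M.
    by rewrite raddfB /= addrAC.
  rewrite mulmxBl Mz mul_scalar_mx !mxE subr_gt0.
  have zs : z p 0 <= s.
    by rewrite /s (bigD1 p) //= lerDl sumr_ge0 // => j _; apply: z_ge0.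
  have es : e * (s + 1) <= 1.
    by rewrite -ler_pdivlMr ?ltr_wpDl // div1r ge_min lexx orbT.
  by nra.
by move=> /(ge_inf S_lb); rewrite -/t0 lerBrDr gerDl leNgt e_gt0.
Qed.

Lemma nonneg_invmx n (A : 'M[R]_n) (r : R) (b : 'cV[R]_n) :
  0 < r -> nonneg_mx A -> (forall t, r <= t -> t%:M - A \in unitmx) ->
  nonneg_vec b -> nonneg_vec (invmx (r%:M - A) *m b).
Proof.
move=> r_gt0 A_ge0 A_unit.
have [z z_ge0 Mz] := nonneg_resolvent r_gt0 A_ge0 A_unit.
have z_gt0 := nonneg_resolvent_gt0 r_gt0 A_ge0 z_ge0 Mz.
by apply: (test_vector_invmx_nonneg A_ge0 z_gt0) => p; rewrite Mz mxE ltr01.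
Qed.

Lemma not_unitmx_eigenvector n (A : 'M[R]_n) (t : R) :
  t%:M - A \notin unitmx -> exists2 v : 'cV[R]_n, v != 0 & A *m v = t *: v.
Proof.
rewrite -unitmx_tr -row_free_unit -kermx_eq0 => /rowV0Pn[v v_ker v_neq0].
exists v^T; first by rewrite -trmx0 (inj_eq (@trmx_inj _ _ _)).
apply/eqP; rewrite eq_sym -subr_eq0 -mul_scalar_mx -mulmxBl.
rewrite -(inj_eq (@trmx_inj _ _ _)) trmx_mul trmxK trmx0.
by apply/eqP/sub_kermxP.
Qed.

Lemma real_eigenvalue_le_spectral_radius n (A : 'M[R]_n) (t : R) :
  (exists2 v : 'cV[R]_n, v != 0 & A *m v = t *: v) -> t <= spectral_radius A.
Proof.
move=> [v v_neq0 Av]; apply: (@le_trans _ _ `|t|); first exact: ler_norm.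
set B := map_mx (real_complex R) A.
(* [eigenvalue] is about row vectors and [v] is a column; the characteristic polynomial, which
   vanishes at t because t - A kills [v], links the two. *)
have Bt : eigenvalue B (real_complex R t).
  rewrite eigenvalue_root_char -map_char_poly fmorph_root /root.
  rewrite -[_.[t]]/(horner_eval t _) -det_map_mx horner_char_poly_mx.
  rewrite -[_ == 0]negbK -unitfE -unitmxE; apply/negP => M_unit.
  have : (t%:M - A) *m v = 0 by rewrite mulmxBl Av mul_scalar_mx subrr.
  move=> /(congr1 (mulmx (invmx (t%:M - A)))).
  by rewrite mulmxA mulVmx // mul1mx mulmx0 => v0; rewrite v0 eqxx in v_neq0.
have normc_t : ComplexField.Normc.normc (real_complex R t) = `|t|.
  by rewrite /= expr0n /= addr0 sqrtr_sqr.
rewrite -normc_t; apply: ub_le_sup; last by exists (real_complex R t).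
(* [ub_le_sup] asks for an upper bound on the moduli: the eigenvalues are roots of the
   characteristic polynomial, and the sum of the moduli of all roots is one. *)
have [s Es] := closed_field_poly_normal (char_poly B).
exists (\sum_(z <- s) ComplexField.Normc.normc z) => _ [z /= Bz <-].
have zs : z \in s.
  move: Bz; rewrite eigenvalue_root_char Es.
  by rewrite (monicP (char_poly_monic B)) scale1r root_prod_XsubC.
rewrite (big_rem z) //= lerDl; apply: sumr_ge0 => w _.
by case: w => a b; rewrite sqrtr_ge0.
Qed.

(* Restrict an eigenvector to a strongly connected class which is minimal among
   those meeting its support: on that class no other class contributes. *)
Lemma eigenvector_minimal_class n (A : 'M[R]_n) (t : R) (v : 'cV[R]_n)
    (c : rel 'I_n) :
  reflexive c -> transitive c -> (forall p q, A p q != 0 -> c p q) ->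
  v != 0 -> A *m v = t *: v ->
  exists2 p, v p 0 != 0 & forall q, c p q && c q p ->
    \sum_(j | c p j && c j p) A q j * v j 0 = t * v q 0.
Proof.
move=> c_refl c_trans A_c v_neq0 Av.
have [p0 vp0] : exists p, v p 0 != 0 by apply/cV0Pn.
case: (@arg_minnP _ p0 (fun p => v p 0 != 0) (fun p => #|c p|) vp0) => p vp p_min.
exists p => // q /andP[pq qp].
have := congr1 (fun w : 'cV_n => w q 0) Av; rewrite !mxE => <-.
rewrite [RHS](bigID (fun j => c p j && c j p)) /= [X in _ + X]big1 ?addr0 //.
move=> j nj; apply/eqP; rewrite mulf_eq0; apply: contraNT nj.
rewrite negb_or => /andP[/A_c qj vj].
(* A contributing j is reachable from p, so what j reaches is contained in what p reaches; p reaches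
   the fewest indices, so both sets agree and j reaches p. *)
have pj : c p j by apply: c_trans qj.
have sub : c j \subset c p by apply/fintype.subsetP => l jl; apply: c_trans jl.
rewrite pj /=; have := p_min _ vj => p_le.
have : c p =i c j.
  apply/fsym/subset_cardP => //; apply/eqP.
  by rewrite eqn_leq p_le subset_leq_card.
by move=> /(_ p); rewrite /in_mem /= c_refl => /esym.
Qed.

End NonnegMatrices.

(** * Consequences of commutation for block triangular matrices *)

Lemma block_triangular_comm (T : pzRingType) m n p
    (E E' : 'M[T]_m) (B B' : 'M[T]_(m, n)) (S S' : 'M[T]_(m, p))
    (A A' : 'M[T]_n) (C C' : 'M[T]_p) :
  let M := block_mx E (row_mx B S) 0 (block_mx A 0 0 C) in
  let M' := block_mx E' (row_mx B' S') 0 (block_mx A' 0 0 C') in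
  M *m M' = M' *m M ->
  E *m E' = E' *m E /\ E *m B' + B *m A' = E' *m B + B' *m A.
Proof.
rewrite /= !mulmx_block => /eq_block_mx[]; rewrite !mulmx0 !addr0 => eqE eqB _ _.
split=> //; move: eqB; rewrite !mul_mx_row !mul_row_block !mulmx0 !addr0.
by rewrite !add_row_mx => /eq_row_mx[].
Qed.

(** On the common eigenvector the block identity reads E B' x + a' B x = E' B x + a B' x;
    rearranged, this is part (a). *)
Lemma scalar_submx_swap (T : comPzRingType) m n p (E E' : 'M[T]_m)
    (B B' : 'M[T]_(m, n)) (A A' : 'M[T]_n) (x : 'M[T]_(n, p)) (a a' : T) :
  E *m B' + B *m A' = E' *m B + B' *m A ->
  A *m x = a *: x -> A' *m x = a' *: x ->
  (a%:M - E) *m (B' *m x) = (a'%:M - E') *m (B *m x).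
Proof.
move=> /(congr1 (mulmx^~ x)) eqx Ax A'x; move: eqx.
rewrite /= !mulmxDl -!mulmxA Ax A'x -!scalemxAr => eqx.
rewrite !mulNmx !mul_scalar_mx.
by apply/eqP; rewrite subr_eq addrAC eq_sym subr_eq [eqbLHS]addrC eqx addrC.
Qed.

(** M = a - E commutes with M' = a' - E', so M' M^-1 b = M^-1 M' b = M^-1 M b' = b'. Only M is
    inverted. *)
Lemma resolvent_swap (T : comUnitRingType) n p (E E' : 'M[T]_n)
    (b b' : 'M[T]_(n, p)) (a a' : T) :
  E *m E' = E' *m E -> a%:M - E \in unitmx ->
  (a%:M - E) *m b' = (a'%:M - E') *m b ->
  (a'%:M - E') *m (invmx (a%:M - E) *m b) = b'.
Proof.
set M := a%:M - E; set M' := a'%:M - E' => EE' M_unit Mb'.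
have MM' : M' *m M = M *m M'.
  apply: comm_mxB; first exact: comm_mx_scalar.
  by apply: comm_mx_sym; apply: comm_mxB; first exact: comm_mx_scalar.
by rewrite -[LHS]mul1mx -{1}(mulVmx M_unit) -!mulmxA (mulmxA M) -MM' -!mulmxA
  (mulmxA M) mulmxV // mul1mx -Mb' mulmxA mulVmx // mul1mx.
Qed.

(** * Vertex matrices commute *)

(* vector.v and ssrfun.v shadow the names hom and comp of the k-graph record. *)
Local Notation hom := Defs.hom.

Section FiniteKGraph.
Variables (k : nat) (L : kgraph k).
Implicit Types (v w : vertex L) (X Y Z : set (vertex L)).
Implicit Types (m n : {ffun 'I_k -> nat}) (i j : 'I_k).

Lemma connected_refl v : connected v v.
Proof. by constructor; apply: idp. Qed.

Lemma connected_trans u v w : connected u v -> connected v w -> connected u w.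
Proof. by move=> [a] [b]; constructor; exact: (Defs.comp a b). Qed.

Lemma deg0_eq v w (l : hom v w) : deg l = 0 -> v = w.
Proof. by move=> /deg0_idp /(congr1 (fun p => (tag p).2)). Qed.

Definition factor_pair v w : choiceType :=
  {u : vertex L & (hom v u * hom u w)%type}.

Definition comp_pair v w (p : factor_pair v w) : hom v w :=
  Defs.comp (tagged p).1 (tagged p).2.

Lemma comp_pair_inj v w m n (p q : factor_pair v w) :
  deg (tagged p).1 = m -> deg (tagged p).2 = n ->
  deg (tagged q).1 = m -> deg (tagged q).2 = n ->
  comp_pair p = comp_pair q -> p = q.
Proof.
move=> p1 p2 q1 q2 pq.
have [r [_ rU]] := factorization (etrans (deg_comp _ _) (congr2 +%R p1 p2)).
by rewrite -(rU p (And3 p1 p2 erefl)); apply: rU; split.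
Qed.

(** Every path is a product of edges: induction on the total degree, splitting off at the range end
    an edge of a colour occurring in the degree. *)
Lemma edge_closed_path_closed (P : vertex L -> Prop) :
  (forall i v w (l : hom v w), deg l = unit_deg i -> P v -> P w) ->
  forall v w, connected v w -> P v -> P w.
Proof.
move=> edgeP v w [l].
move: {2}(\sum_i deg l i)%N (erefl (\sum_i deg l i)%N) => N.
elim: N v l => [|N IH] v l degN Pv.
  suff /deg0_eq <- : deg l = 0 by [].
  apply/ffunP => i; rewrite ffunE; apply/eqP.
  by move/eqP: degN; rewrite sum_nat_eq0 => /forallP/(_ i).
have [i li] : exists i, deg l i != 0%N.
  apply/existsP; rewrite -[[exists _, _]]negbK negb_exists; apply/negP.
  move=> /forallP l0; move: degN; rewrite big1 // => i _.
  by have := l0 i; rewrite negbK => /eqP.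
pose n : {ffun 'I_k -> nat} := [ffun j => (deg l j - (j == i))%N].
have degl : deg l = unit_deg i + n.
  apply/ffunP => j; rewrite !ffunE; case: eqVneq => [->|_] /=.
    by rewrite [RHS]subnKC ?lt0n.
  by rewrite subn0 add0r.
have [[u [a b]] /= [[dega degb _] _]] := factorization degl.
apply: (IH u b); last exact: (edgeP _ _ _ _ dega Pv).
move: degN; rewrite degl degb (eq_bigr (fun j => (j == i) + n j)%N); last first.
  by move=> j _; rewrite !ffunE.
rewrite big_split /= (bigD1 i) //= eqxx big1 ?addn0; last by move=> j /negbTE ->.
by rewrite add1n => -[].
Qed.

Hypothesis finL : finite_kgraph L.

(** The identities are pairwise distinct paths of degree 0, and there are finitely many of those. *)
Lemma finite_vertices X : finite_set X.
Proof.
apply: (@sub_finite_set _ _ setT) => //.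
have -> : [set: vertex L] =
    (fun v => mkpath (idp v)) @^-1` [set p : Defs.path L | path_deg p = 0].
  by apply/seteqP; split=> // v _; apply: deg_idp.
by apply: finite_preimage (finL 0) => v w _ _ /(congr1 (fun p => (tag p).1)).
Qed.

Lemma finite_hom_deg v w n : finite_set [set l : hom v w | deg l = n].
Proof.
have -> : [set l : hom v w | deg l = n] =
    (fun l => mkpath l) @^-1` [set p : Defs.path L | path_deg p = n] by [].
apply: finite_preimage (finL n) => l l' _ _ /eqP.
by rewrite eq_Tagged => /eqP.
Qed.

Lemma mem_fset_hom v w n (l : hom v w) :
  (l \in fset_set [set l : hom v w | deg l = n]) = (deg l == n).
Proof.
rewrite in_fset_set; last exact: finite_hom_deg.
by apply/idP/eqP; rewrite inE.
Qed.

Lemma edge_count_gt0 i v w :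
  (0 < edge_count i v w)%N <-> exists l : hom v w, deg l = unit_deg i.
Proof.
rewrite /edge_count cardfs_gt0; split=> [/fset0Pn[l]|[l degl]].
  by rewrite mem_fset_hom => /eqP; exists l.
by apply/fset0Pn; exists l; rewrite mem_fset_hom degl.
Qed.

Lemma edge_count_neq0_connected i v w : edge_count i v w != 0%N -> connected v w.
Proof. by rewrite -lt0n => /edge_count_gt0[l _]. Qed.

Lemma edge_count_not_connected i v w : ~ connected v w -> edge_count i v w = 0%N.
Proof.
move=> vw; apply/eqP; apply: contra_notT vw.
exact: edge_count_neq0_connected.
Qed.

Lemma elt_inj X : injective (@elt k L X).
Proof. by apply/tuple_uniqP/fset_uniq. Qed.

Lemma elt_mem X p : X (@elt k L X p).
Proof.
have := mem_tnth p (in_tuple (enum_fset (fset_set X))).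
by rewrite memtE /= in_fset_set ?inE //; apply: finite_vertices.
Qed.

Lemma elt_surj X v : X v -> exists p, @elt k L X p = v.
Proof.
move=> Xv; have /tnthP[p ->] : v \in in_tuple (enum_fset (fset_set X)).
  by rewrite memtE /= in_fset_set ?inE //; apply: finite_vertices.
by exists p.
Qed.

Lemma elt3_l X Y Z p : elt3 X Y Z (lshift _ p) = elt p.
Proof. by rewrite /elt3 (unsplitK (inl p)). Qed.

Lemma elt3_m X Y Z p : elt3 X Y Z (rshift _ (lshift _ p)) = elt p.
Proof. by rewrite /elt3 (unsplitK (inr _)) (unsplitK (inl p)). Qed.

Lemma elt3_r X Y Z p : elt3 X Y Z (rshift _ (rshift _ p)) = elt p.
Proof. by rewrite /elt3 (unsplitK (inr _)) (unsplitK (inr p)). Qed.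

Definition elt3E := (elt3_l, elt3_m, elt3_r).

Lemma elt3_bij X Y Z : X `|` Y `|` Z = setT -> X `&` Y = set0 ->
  X `&` Z = set0 -> Y `&` Z = set0 -> bijective (elt3 X Y Z).
Proof.
move=> XYZ XY XZ YZ.
have disj U V p q : U `&` V = set0 -> @elt k L U p = @elt k L V q -> False.
  move=> UV pq; have : (U `&` V) (elt p).
    by split; [|rewrite pq]; apply: elt_mem.
  by rewrite UV.
have inj : injective (elt3 X Y Z).
  move=> p q; case: (split_ordP p) => [{}p ->|{}p ->];
    case: (split_ordP q) => [{}q ->|{}q ->].
  - by rewrite !elt3E => /elt_inj ->.
  - by case: (split_ordP q) => [{}q ->|{}q ->]; rewrite !elt3E => /disj -/(_ _) [].
  - by case: (split_ordP p) => [{}p ->|{}p ->]; rewrite !elt3E => /esym/disj -/(_ _) [].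
  case: (split_ordP p) => [{}p ->|{}p ->];
    case: (split_ordP q) => [{}q ->|{}q ->]; rewrite !elt3E.
  - by move=> /elt_inj ->.
  - by move=> /disj -/(_ _) [].
  - by move=> /esym/disj -/(_ _) [].
  - by move=> /elt_inj ->.
have /choice[g gK] : forall v, exists p, elt3 X Y Z p = v.
  move=> v; have : (X `|` Y `|` Z) v by rewrite XYZ.
  move=> [[|]|] /elt_surj[p <-].
  - by exists (lshift _ p); rewrite elt3E.
  - by exists (rshift _ (lshift _ p)); rewrite elt3E.
  - by exists (rshift _ (rshift _ p)); rewrite elt3E.
by exists g => // p; apply: inj; rewrite gK.
Qed.

(** By unique factorization, composition is a bijection from composable pairs of degrees e_i and e_j
    onto paths of degree e_i + e_j. The right side is symmetric in i and j, hence the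
    commutation. *)
Lemma sum_edge_count N (f : 'I_N -> vertex L) i j v w : bijective f ->
  (\sum_p edge_count i v (f p) * edge_count j (f p) w)%N =
  #|` fset_set [set l : hom v w | deg l = (unit_deg i + unit_deg j)%R]|%fset.
Proof.
move=> [g fK gK].
pose ab p : seq (hom v (f p) * hom (f p) w) :=
  [seq (a, b) | a <- enum_fset (fset_set [set l | deg l = unit_deg i]),
                b <- enum_fset (fset_set [set l | deg l = unit_deg j])].
pose T u := (hom v u * hom u w)%type.
(* All composable pairs, tagged by their middle vertex; as [f] is bijective, each middle vertex is
   visited exactly once. *)
pose s : seq (factor_pair v w) :=
  [seq @Tagged _ (f p) T t | p <- enum 'I_N, t <- ab p].
have abE p t : (t \in ab p) = (deg t.1 == unit_deg i) && (deg t.2 == unit_deg j).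
  case: t => a b; apply/allpairsP/andP => [[[a' b'] /= [a's b's [-> ->]]]|[degs degt]].
    by split; [move: a's | move: b's]; rewrite mem_fset_hom.
  by exists (a, b); split=> //=; rewrite mem_fset_hom.
have sE (t : factor_pair v w) :
    (t \in s) = (deg (tagged t).1 == unit_deg i) && (deg (tagged t).2 == unit_deg j).
  apply/allpairsPdep/idP => [[p [t' [_ t'ab ->]]]|]; first by rewrite -abE.
  case: t => u t /= degt; rewrite -(gK u) in t degt *.
  by exists (g u), t; rewrite mem_enum abE; split.
have s_uniq : uniq s.
  apply: allpairs_uniq_dep => [|p _|]; first exact: enum_uniq.
    by apply: allpairs_uniq; rewrite ?fset_uniq // => -[? ?] [? ?] _ _ [-> ->].
  move=> [p t] [p' t'] _ _ /= e.
  have pp' : p = p' by apply: (can_inj fK); apply: (congr1 tag e).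
  subst p'; move/eqP: e; rewrite eq_Tagged => /eqP /= -> //.
transitivity (size (map (@comp_pair v w) s)).
  rewrite size_map size_allpairs_dep sumnE big_map [RHS]big_enum /=.
  by apply: eq_bigr => p _; rewrite size_allpairs.
apply/perm_size/uniq_perm; rewrite ?fset_uniq //.
  rewrite map_inj_in_uniq // => t t'; rewrite !sE.
  move=> /andP[/eqP a1 /eqP a2] /andP[/eqP b1 /eqP b2].
  exact: (comp_pair_inj a1 a2 b1 b2).
move=> l; rewrite mem_fset_hom; apply/mapP/eqP => [[t] |degl].
  rewrite sE => /andP[/eqP e1 /eqP e2] ->.
  by rewrite /comp_pair deg_comp e1 e2.
have [t [[e1 e2 <-] _]] := factorization degl.
by exists t => //; rewrite sE e1 e2 !eqxx.
Qed.

Lemma edge_mx_comm (R : realType) N (f : 'I_N -> vertex L) i j : bijective f ->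
  edge_mx R f f i *m edge_mx R f f j = edge_mx R f f j *m edge_mx R f f i.
Proof.
move=> f_bij; apply/matrixP => p q; rewrite !mxE.
have sumE i' j' : \sum_r edge_mx R f f i' p r * edge_mx R f f j' r q =
    (\sum_r edge_count i' (f p) (f r) * edge_count j' (f r) (f q))%:R.
  by rewrite natr_sum; apply: eq_bigr => r _; rewrite !mxE natrM.
by rewrite !sumE !sum_edge_count // addrC.
Qed.

End FiniteKGraph.

(** * Strongly connected components *)

Section VertexBlocks.
Variables (R : realType) (k : nat) (L : kgraph k).
Hypothesis finL : finite_kgraph L.
Implicit Types (D F X Y : set (vertex L)) (i : 'I_k).

Lemma vertex_block_nonneg X Y i : nonneg_mx (vertex_block R X Y i).
Proof. by move=> p q; rewrite mxE ler0n. Qed.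

Lemma vertex_block_eq0 X Y i :
  (forall v w, X v -> Y w -> ~ connected v w) -> vertex_block R X Y i = 0.
Proof.
move=> XY; apply/matrixP => p q; rewrite !mxE edge_count_not_connected //.
by apply: XY; apply: elt_mem.
Qed.

Lemma scc_refl (v : vertex L) : scc v v.
Proof. by split; apply: connected_refl. Qed.

(** A loop of colour i would be the identity, whose degree is 0 and not e_i. *)
Lemma trivial_component_no_loop (v : vertex L) i :
  trivial_component (scc v) -> edge_count i v v = 0%N.
Proof.
move=> [u [Eu idp_only]]; have -> : v = u by have := scc_refl v; rewrite Eu.
apply/eqP; rewrite -leqn0 leqNgt; apply/negP => /(edge_count_gt0 finL)[l].
by rewrite (idp_only l) deg_idp => /ffunP/(_ i); rewrite !ffunE eqxx.
Qed.

Lemma unitmx_above_components F i (r : R) : 0 < r ->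
  (forall v, F v -> ~ trivial_component (scc v) ->
     scc v `<=` F /\ spectral_radius (vertex_block R (scc v) (scc v) i) < r) ->
  forall t, r <= t -> t%:M - vertex_block R F F i \in unitmx.
Proof.
move=> r_gt0 F_comp t rt; apply: contraT.
move=> /not_unitmx_eigenvector[v v_neq0 Av].
pose c : rel 'I_(vcard F) := fun p q => `[<connected (elt p) (elt q)>].
have c_refl : reflexive c by move=> p; apply/asboolP/connected_refl.
have c_trans : transitive c.
  by move=> q p s /asboolP pq /asboolP qs; apply/asboolP/(connected_trans pq qs).
have A_c p q : vertex_block R F F i p q != 0 -> c p q.
  rewrite mxE pnatr_eq0 => /(edge_count_neq0_connected finL) pq.
  exact/asboolP.
have [p vp classE] := eigenvector_minimal_class c_refl c_trans A_c v_neq0 Av.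
pose C := scc (elt p).
have classP q : (c p q && c q p) = `[<C (elt q)>].
  by rewrite /c -asbool_and.
have [C_triv|C_nontriv] := pselect (trivial_component C).
  (* A trivial class is one vertex without loops, so the class sum vanishes, against t >= r > 0 and
     v p != 0. *)
  suff : t * v p 0 = 0.
    move=> /eqP; rewrite mulf_eq0 (negbTE vp) orbF => /eqP t0.
    by move: (lt_le_trans r_gt0 rt); rewrite t0 ltxx.
  rewrite -classE ?c_refl // big1 // => q; rewrite classP => /asboolP Cq.
  have [u [Cu _]] := C_triv.
  have pq : elt p = elt q.
    have : C (elt p) by apply: scc_refl.
    by move: Cq; rewrite Cu /= => -> ->.
  by rewrite mxE -pq trivial_component_no_loop ?mul0r.
have [CF rhoC] := F_comp _ (elt_mem finL p) C_nontriv.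
(* The class sum runs over indices of F, the block of C over indices of C; [h] embeds the latter in
   the former with image the class. *)
have /choice[h hE] : forall a : 'I_(vcard C), exists q : 'I_(vcard F), elt q = elt a.
  by move=> a; apply: (elt_surj finL); apply: CF; apply: (elt_mem finL a).
have h_inj : injective h by move=> a b hab; apply: elt_inj; rewrite -!hE hab.
have hC q : (c p q && c q p) = (q \in h @: [set: 'I_(vcard C)]%SET).
  rewrite classP; apply/asboolP/imsetP => [Cq|[a _ ->]].
    have [a aq] := elt_surj finL Cq; exists a; rewrite ?finset.inE //.
    by apply: elt_inj; rewrite hE.
  by rewrite hE; apply: elt_mem.
suff : t <= spectral_radius (vertex_block R C C i).
  by move=> /le_lt_trans /(_ rhoC); rewrite ltNge rt.
apply: real_eigenvalue_le_spectral_radius.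
exists (\col_a v (h a) 0).
  have [a ap] := elt_surj finL (scc_refl (elt p)).
  apply/cV0Pn; exists a; rewrite mxE; suff -> : h a = p by [].
  by apply: elt_inj; rewrite hE.
apply/colP => a; rewrite !mxE -classE; last first.
  by rewrite hC; apply: imset_f; rewrite finset.inE.
rewrite (eq_bigl _ _ hC) big_imset /=; last by move=> ? ? _ _; apply: h_inj.
rewrite (eq_bigl _ _ (fun b => finset.in_setT b)).
by apply: eq_bigr => b _; rewrite !mxE !hE.
Qed.

(** * The common eigenvector on a hereditary strongly connected set *)

Section CommonEigenvector.
Variables (D : set (vertex L)) (x : 'cV[R]_(vcard D)) (rho : 'I_k -> R).
Hypothesis D_sconn : forall v w, D v -> D w -> connected v w.
Hypothesis D_hered : hereditary D.
Hypothesis x_ge0 : nonneg_vec x.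
Hypothesis x_eigen : forall i, eigenvector (vertex_block R D D i) (rho i) x.

(** Heredity puts w in D. The edge makes A_i(p, q) >= 1, and all other terms of (A_i x)_p = rho_i
    x_p are nonnegative. *)
Lemma edge_eigenvector_le p i w (l : hom (@elt k L D p) w) : deg l = unit_deg i ->
  exists2 q, elt q = w & x q 0 <= rho i * x p 0.
Proof.
move=> degl.
have [q qw] : exists q, @elt k L D q = w.
  by apply: (elt_surj finL); apply: (D_hered (elt_mem finL p)); constructor.
exists q => //.
have [_ /(congr1 (fun u : 'cV_ _ => u p 0))] := x_eigen i.
rewrite !mxE => <-; rewrite (bigD1 q) //= ler_wpDr //.
  by apply: sumr_ge0 => j _; rewrite mulr_ge0 ?vertex_block_nonneg.
rewrite mxE -[leLHS]mul1r ler_wpM2r // ler1n qw.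
by apply/(edge_count_gt0 finL); exists l.
Qed.

(* The zero set of x is closed under following edges, hence under paths. *)
Lemma eigenvector_gt0 p : x != 0 -> 0 < x p 0.
Proof.
move=> /cV0Pn[q xq]; rewrite lt0r x_ge0 andbT; apply: contra xq => /eqP xp.
pose P v := exists2 q, @elt k L D q = v & x q 0 = 0.
suff [q' /elt_inj -> ->] : P (elt q) by [].
apply: (@edge_closed_path_closed _ _ P _ (elt p)); last by exists p.
- move=> i v w l degl [q' q'v xq']; move: l degl; rewrite -q'v => l degl.
  have [s sw] := edge_eigenvector_le degl; rewrite xq' mulr0 => xs.
  by exists s => //; apply/eqP; rewrite eq_le xs x_ge0.
- by apply: D_sconn; apply: (elt_mem finL).
Qed.

(** Some edge of colour i has range p, as there are no sources; its source q then satisfies 0 < x q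
    <= rho_i x p. *)
Lemma common_eigenvalue_gt0 i : no_sources L -> 0 < rho i.
Proof.
have [x_neq0 _] := x_eigen i; have /cV0Pn[p _] := x_neq0.
move=> nosrc; have [w [l degl]] := nosrc (elt p) (unit_deg i).
have [q _] := edge_eigenvector_le degl.
move=> /(lt_le_trans (eigenvector_gt0 q x_neq0)).
by rewrite pmulr_lgt0 // eigenvector_gt0.
Qed.

End CommonEigenvector.
End VertexBlocks.

(** * The decomposition along F, D, H and the joint eigenvector (y, x, 0) *)

Theorem proposition4p1 (R : realType) (k : nat) (L : kgraph k)
    (D : set (vertex L)) (x : 'cV[R]_(vcard D)) :
  finite_kgraph L -> no_sinks L -> no_sources L ->
  nontrivial_components D -> hereditary D ->
  dominant_colours R D !=set0 ->
  nonneg_vec x ->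
  (forall i : 'I_k, eigenvector (vertex_block R D D i)
     (spectral_radius (vertex_block R D D i)) x) ->
  let H : set (vertex L) := [set v | ~ connected_sets [set v] D] in
  let F : set (vertex L) := ~` (D `|` H) in
  let LD : set 'I_k := dominant_colours R D in
  let A (i : 'I_k) := edge_mx R (elt3 F D H) (elt3 F D H) i in
  let AD (i : 'I_k) := vertex_block R D D i in
  let AH (i : 'I_k) := vertex_block R H H i in
  let E (i : 'I_k) := vertex_block R F F i in
  let B (i : 'I_k) := vertex_block R F D i in
  let rho (i : 'I_k) : R := spectral_radius (AD i) in
  [/\ [/\ F `|` D `|` H = setT, F `&` D = set0, F `&` H = set0,
          D `&` H = set0 & bijective (elt3 F D H)],
      (forall i : 'I_k, exists S : 'M[R]_(vcard F, vcard H),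
         A i = block_mx (E i) (row_mx (B i) S)
                        0     (block_mx (AD i) 0
                                        0      (AH i))),
      (forall i j : 'I_k,
         ((rho i)%:M - E i) *m (B j *m x) = ((rho j)%:M - E j) *m (B i *m x)) &
      [/\ (forall i : 'I_k, LD i -> (rho i)%:M - E i \in unitmx),
          (forall i j : 'I_k, LD i -> LD j ->
             invmx ((rho i)%:M - E i) *m (B i *m x)
             = invmx ((rho j)%:M - E j) *m (B j *m x)) &
          (forall i0 : 'I_k, LD i0 ->
             let y := invmx ((rho i0)%:M - E i0) *m (B i0 *m x) in
             nonneg_vec y /\
             forall i : 'I_k,
               eigenvector (A i) (rho i) (col_mx y (col_mx x 0)))]].
Proof.
move=> finL _ nosrc [[d0 D_scc] _] D_hered _ x_ge0 x_eigen H F LD A AD AH E B rho.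
have D_sconn v w : D v -> D w -> connected v w.
  by rewrite D_scc => -[_ vd] [dw _]; apply: connected_trans vd dw.
have H_hered : hereditary H.
  move=> v w Hv vw [_ [u [-> Du wu]]]; apply: Hv.
  by exists v, u; split=> //; apply: connected_trans vw wu.
have FDH : F `|` D `|` H = setT by rewrite -setUA setUC setUv.
have FD0 : F `&` D = set0.
  by apply/seteqP; split=> // v [Fv Dv]; apply: Fv; left.
have FH0 : F `&` H = set0.
  by apply/seteqP; split=> // v [Fv Hv]; apply: Fv; right.
have DH0 : D `&` H = set0.
  apply/seteqP; split=> // v [Dv]; apply.
  by exists v, v; split=> //; apply: connected_refl.
have bij : bijective (elt3 F D H) by apply: elt3_bij.
have blockA i : A i = block_mx (E i) (row_mx (B i) (vertex_block R F H i))
                        0 (block_mx (AD i) 0 0 (AH i)).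
  have disj X Y v : X `&` Y = set0 -> X v -> ~ Y v.
    by move=> XY Xv Yv; have : (X `&` Y) v; [|rewrite XY].
  (* The four zero blocks come from heredity: a path with range in D, or in H, has its source there
     too. *)
  have zDF : vertex_block R D F i = 0.
    apply: vertex_block_eq0 => // v w Dv Fw /(D_hered _ _ Dv).
    exact: disj FD0 Fw.
  have zDH : vertex_block R D H i = 0.
    apply: vertex_block_eq0 => // v w Dv Hw /(D_hered _ _ Dv) Dw.
    exact: disj DH0 Dw Hw.
  have zHF : vertex_block R H F i = 0.
    apply: vertex_block_eq0 => // v w Hv Fw /(H_hered _ _ Hv).
    exact: disj FH0 Fw.
  have zHD : vertex_block R H D i = 0.
    apply: vertex_block_eq0 => // v w Hv Dw /(H_hered _ _ Hv).
    exact: disj DH0 Dw.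
  apply/matrixP => p q; case: (split_ordP p) => [{}p ->|{}p ->];
    case: (split_ordP q) => [{}q ->|{}q ->].
  - by rewrite block_mxEul !mxE !elt3E.
  - rewrite block_mxEur; case: (split_ordP q) => [{}q ->|{}q ->].
      by rewrite row_mxEl !mxE !elt3E.
    by rewrite row_mxEr !mxE !elt3E.
  - rewrite block_mxEdl; case: (split_ordP p) => [{}p ->|{}p ->].
      by have /matrixP/(_ p q) := zDF; rewrite !mxE !elt3E.
    by have /matrixP/(_ p q) := zHF; rewrite !mxE !elt3E.
  - rewrite block_mxEdr; case: (split_ordP p) => [{}p ->|{}p ->];
      case: (split_ordP q) => [{}q ->|{}q ->].
    + by rewrite block_mxEul !mxE !elt3E.
    + by have /matrixP/(_ p q) := zDH; rewrite block_mxEur !mxE !elt3E.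
    + by have /matrixP/(_ p q) := zHD; rewrite block_mxEdl !mxE !elt3E.
    + by rewrite block_mxEdr !mxE !elt3E.
have [Ecomm EBcomm] : (forall i j, E i *m E j = E j *m E i) /\
    (forall i j, E i *m B j + B i *m AD j = E j *m B i + B j *m AD i).
  by split=> i j; have := edge_mx_comm finL R i j bij;
    rewrite -/(A i) -/(A j) !blockA => /block_triangular_comm[].
have ADx i : AD i *m x = rho i *: x by case: (x_eigen i).
have part_a i j : ((rho i)%:M - E i) *m (B j *m x) =
    ((rho j)%:M - E j) *m (B i *m x).
  exact: scalar_submx_swap (EBcomm i j) (ADx i) (ADx j).
have rho_gt0 i : 0 < rho i.
  exact: (common_eigenvalue_gt0 finL D_sconn D_hered x_ge0 x_eigen).
have M_unit i t : LD i -> rho i <= t -> t%:M - E i \in unitmx.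
  move=> LDi; apply: unitmx_above_components => // v Fv v_nontriv.
  (* A vertex v of F satisfies v Lambda D nonempty, being outside H. Its component avoids D, since
     heredity would put v in D, and avoids H, since each member connects to D through v. So it
     differs from D and is covered by the condition defining L_D. *)
  have vD : connected_sets [set v] D by apply: contrapT => Hv; apply: Fv; right.
  split=> [w [vw wv] [Dw|Hw]|].
  - by apply: Fv; left; apply: D_hered Dw wv.
  - apply: Hw; have [_ [u [-> Du vu]]] := vD.
    by exists w, u; split=> //; apply: connected_trans wv vu.
  apply: LDi.
  - by split=> //; exists v.
  - by move=> vD_eq; apply: Fv; left; rewrite -vD_eq; apply: scc_refl.
  - have [_ [u [-> Du vu]]] := vD.
    by exists v, u; split=> //; apply: scc_refl.
pose y i := invmx ((rho i)%:M - E i) *m (B i *m x).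
(* Here j is any colour. For j in L_D, inverting gives independence of the choice; for general j
   this is the top row of the eigenvector equation. *)
have yE i j : LD i -> ((rho j)%:M - E j) *m y i = B j *m x.
  move=> LDi; apply: resolvent_swap (part_a i j) => //.
  exact: M_unit (lexx _).
split=> //; first by move=> i; exists (vertex_block R F H i).
split=> [i LDi|i j LDi LDj|i LDi y0].
- exact: M_unit (lexx _).
- by rewrite -(yE i j LDi) [RHS]mulmxA mulVmx ?mul1mx // M_unit.
split=> [|j].
  apply: nonneg_invmx => //; first exact: vertex_block_nonneg.
    by move=> t; apply: M_unit.
  exact: (nonneg_mulmx_vec (@vertex_block_nonneg _ _ _ _ _ _) x_ge0).
split.
  have [x_neq0 _] := x_eigen i; apply: contra x_neq0.
  by rewrite !col_mx_eq0 => /and3P[].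
have Ey : E j *m y0 + B j *m x = rho j *: y0.
  by rewrite -(yE i j LDi) -/(y i) mulmxBl mul_scalar_mx addrC subrK.
rewrite blockA mul_block_col mul_row_col mul_block_col.
by rewrite !mulmx0 !mul0mx !addr0 !add0r Ey ADx !scale_col_mx scaler0.
Qed.
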